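(* Let $\nu>0$ and assume $f \in C^{1,1}_\nu(\mathbb{R}^n)$. Let $\mathbf{x}_0\in\mathbb{R}^n$ be a fixed vector and $\Theta=\{\mathbf{x}_1,\dots,\mathbf{x}_{n+1}\}\subset\mathbb{R}^n$ a fixed set of $n+1$ affinely independent vectors. Let $\hat f$ be the affine function that interpolates $f$ on $\Theta$. Then $|\hat f(\mathbf{x}_0)-f(\mathbf{x}_0)|\le\bar z(\Theta,\mathbf{x}_0)$, where $$\bar z(\Theta,\mathbf{x}_0):=\frac{\nu}{2}\sum_{i=0}^{n+1}|\ell_i(\mathbf{x}_0)|\,\|\mathbf{x}_i-\mathbf{w}\|^2,\qquad \mathbf{w}=\frac{\sum_{i=0}^{n+1}|\ell_i(\mathbf{x}_0)|\,\mathbf{x}_i}{\sum_{i=0}^{n+1}|\ell_i(\mathbf{x}_0)|}.$$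
   Context: $\|\cdot\|$ is the Euclidean norm. $C^{1,1}_\nu(\mathbb{R}^n)$ is the class of continuously differentiable functions $f:\mathbb{R}^n\to\mathbb{R}$ whose derivative satisfies $\|Df(\mathbf{u})-Df(\mathbf{v})\|\le\nu\|\mathbf{u}-\mathbf{v}\|$ for all $\mathbf{u},\mathbf{v}\in\mathbb{R}^n$. The interpolating affine function $\hat f$ is the unique affine function with $\hat f(\mathbf{x}_i)=f(\mathbf{x}_i)$ for $i=1,\dots,n+1$. For $i=1,\dots,n+1$, $\ell_i$ is the Lagrange polynomial of $\Theta$, i.e. the unique affine function with $\ell_i(\mathbf{x}_j)=1$ if $j=i$ and $\ell_i(\mathbf{x}_j)=0$ if $j\ne i$ ($j=1,\dots,n+1$); additionally $\ell_0$ is the constant function $\ell_0\equiv-1$. *)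

(* Defs.v *)
From mathcomp Require Import all_boot all_order all_algebra.
From mathcomp Require Import all_classical all_reals all_analysis.

Set Implicit Arguments.
Unset Strict Implicit.
Unset Printing Implicit Defensive.

Import Order.TTheory GRing.Theory Num.Theory.
Import numFieldNormedType.Exports.

Local Open Scope ring_scope.

Section Definitions.
Context {R : realType} {n : nat}.

(* The library norm `|u| on 'rV[R]_n is the sup norm. The topology (hence
   differentiability and continuity below) is the same for both norms. *)
Definition enorm (u : 'rV[R]_n) : R := Num.sqrt (\sum_(j < n) (u 0 j) ^+ 2).

(* The Fréchet derivative 'd f u : 'rV[R]_n -> R as the row vector of its values
   on the standard basis, so that its Euclidean norm makes sense. *)
Definition Df (f : 'rV[R]_n -> R) (u : 'rV[R]_n) : 'rV[R]_n :=
  \row_j 'd f u (delta_mx 0 j).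

Definition C11 (nu : R) (f : 'rV[R]_n -> R) : Prop :=
  [/\ forall u, differentiable f u,
      continuous (Df f)
    & forall u v, enorm (Df f u - Df f v) <= nu * enorm (u - v)].

Definition affine_fun (g : 'rV[R]_n -> R) : Prop :=
  exists (L : {scalar 'rV[R]_n}) (b : R), forall u, g u = L u + b.

Definition affinely_independent (m : nat) (p : 'I_m -> 'rV[R]_n) : Prop :=
  forall c : 'I_m -> R,
    \sum_i c i = 0 -> \sum_i c i *: p i = 0 -> forall i, c i = 0.

(* A family x : 'I_n.+2 -> 'rV[R]_n lists x_0, x_1, ..., x_{n+1}: the index ord0
   is 0 and the indices lift ord0 i, i : 'I_n.+1, are 1, ..., n+1. *)
Definition Theta (x : 'I_n.+2 -> 'rV[R]_n) (i : 'I_n.+1) : 'rV[R]_n :=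
  x (lift ord0 i).

Definition interpolant (p : 'I_n.+1 -> 'rV[R]_n) (f fhat : 'rV[R]_n -> R) :
    Prop :=
  affine_fun fhat /\ forall i, fhat (p i) = f (p i).

Definition lagrange_family (p : 'I_n.+1 -> 'rV[R]_n)
    (ell : 'I_n.+2 -> 'rV[R]_n -> R) : Prop :=
  (forall u, ell ord0 u = -1) /\
  (forall i : 'I_n.+1, affine_fun (ell (lift ord0 i)) /\
     forall j : 'I_n.+1, ell (lift ord0 i) (p j) = (j == i)%:R).

Definition wpoint (x : 'I_n.+2 -> 'rV[R]_n) (ell : 'I_n.+2 -> 'rV[R]_n -> R) :
    'rV[R]_n :=
  (\sum_i `|ell i (x ord0)|)^-1 *: \sum_i `|ell i (x ord0)| *: x i.

Definition zbar (nu : R) (x : 'I_n.+2 -> 'rV[R]_n)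
    (ell : 'I_n.+2 -> 'rV[R]_n -> R) : R :=
  nu / 2 * \sum_i `|ell i (x ord0)| * enorm (x i - wpoint x ell) ^+ 2.

End Definitions.

(* Main.v *)
Require Import Defs.
From mathcomp Require Import all_boot all_order all_algebra.
From mathcomp Require Import all_classical all_reals all_analysis.
From mathcomp Require Import lra.

Import Order.TTheory GRing.Theory Num.Theory.
Import numFieldNormedType.Exports.

Local Open Scope ring_scope.

(** Put c_i = ell_i(x_0) for i = 0, ..., n+1, so that c_0 = -1. The values
    ell_1(u), ..., ell_{n+1}(u) are the barycentric coordinates of u with
    respect to Theta ([lagrange_barycentric]), and affine functions commute with
    barycentric combinations ([affine_fun_barycentric]). Applied to fhat this
    gives
      fhat(x_0) - f(x_0) = sum_i c_i f(x_i),
    and applied to any affine g it gives sum_i c_i g(x_i) = 0.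

    Take for g the first-order Taylor polynomial of f at a point w, and subtract:
      fhat(x_0) - f(x_0) = sum_i c_i (f(x_i) - f(w) - 'd f w (x_i - w)).
    The remainder at x_i is at most nu/2 ||x_i - w||^2 in absolute value since
    the derivative of f is nu-Lipschitz ([taylor1_C11]); summing with the weights
    |c_i| gives the bound. The argument holds for every w; the barycentre in the
    statement is the w that makes the resulting bound smallest. *)

Lemma enorm_sqr {R : realType} {n : nat} (u : 'rV[R]_n) :
  enorm u ^+ 2 = \sum_j u 0 j ^+ 2.
Proof. by rewrite sqr_sqrtr // sumr_ge0 // => j _; rewrite sqr_ge0. Qed.

Lemma enorm_scale_ge0 {R : realType} {n : nat} (a : R) (u : 'rV[R]_n) :
  0 <= a -> enorm (a *: u) = a * enorm u.
Proof.
move=> a0; rewrite /enorm.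
under eq_bigr do rewrite mxE exprMn.
by rewrite -mulr_sumr sqrtrM ?sqr_ge0 // sqrtr_sqr ger0_norm.
Qed.

(** The case of the Cauchy-Schwarz inequality in which one norm is controlled by
    the other. The hypothesis gives the right weight s for Young's inequality
    2 s x y <= s^2 x^2 + y^2, which is then summed coordinate by coordinate. *)
Lemma dot_le_of_enorm_le {R : realType} {n : nat} (s : R) (a d : 'rV[R]_n) :
  0 < s -> enorm a <= s * enorm d ->
  `|\sum_j d 0 j * a 0 j| <= s * enorm d ^+ 2.
Proof.
move=> s0 had.
have ha2 : enorm a ^+ 2 <= s ^+ 2 * enorm d ^+ 2.
  by rewrite -exprMn ler_sqr ?nnegrE ?mulr_ge0 ?sqrtr_ge0 // ltW.
have young : 2 * s * `|\sum_j d 0 j * a 0 j|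
    <= s ^+ 2 * enorm d ^+ 2 + enorm a ^+ 2.
  rewrite !enorm_sqr; apply: (@le_trans _ _ (2 * s * \sum_j `|d 0 j * a 0 j|)).
    by apply: ler_wpM2l; [rewrite mulr_ge0 // ltW|exact: ler_norm_sum].
  rewrite !mulr_sumr -big_split /=; apply: ler_sum => j _.
  rewrite normrM -[d 0 j ^+ 2]real_normK ?num_real //.
  rewrite -[a 0 j ^+ 2]real_normK ?num_real //.
  have := sqr_ge0 (s * `|d 0 j| - `|a 0 j|); lra.
rewrite -(ler_pM2l s0); lra.
Qed.

Lemma diff_Df {R : realType} {n : nat} (f : 'rV[R]_n -> R) (u d : 'rV[R]_n) :
  'd f u d = \sum_j d 0 j * Df f u 0 j.
Proof.
rewrite {1}(row_sum_delta d) linear_sum; apply: eq_bigr => j _.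
by rewrite linearZ /= mxE.
Qed.

(** Turns a difference of directional derivatives into a scalar product with a
    difference of gradients, whose norm the Lipschitz condition bounds. *)
Lemma diff_subr_Df {R : realType} {n : nat} (f : 'rV[R]_n -> R)
    (u v d : 'rV[R]_n) :
  'd f u d - 'd f v d = \sum_j d 0 j * (Df f u - Df f v) 0 j.
Proof.
apply: etrans (congr2 (fun a b => a - b) (diff_Df f u d) (diff_Df f v d)) _.
rewrite -sumrB; move: (Df f u) (Df f v) => a b.
by apply: eq_bigr => j _; rewrite -mulrBr !mxE.
Qed.

(** Restricting to a line reduces the Taylor estimate to one real variable. The
    difference quotients of the restriction are literally those of f in the
    direction d, so no chain rule is involved. *)
Lemma is_derive_line {R : realType} {n : nat} (f : 'rV[R]_n -> R)
    (w d : 'rV[R]_n) (t : R) :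
  differentiable f (w + t *: d) ->
  is_derive t 1 (fun r => f (w + r *: d)) ('d f (w + t *: d) d).
Proof.
move=> df.
have E : (fun h : R => h^-1 *: (f (w + (h *: 1 + t) *: d) - f (w + t *: d)))
       = (fun h : R => h^-1 *: (f (h *: d + (w + t *: d)) - f (w + t *: d))).
  apply/funext => h; congr (_ *: (f _ - _)).
  by rewrite scalerDl [_%:A]mulr1 addrCA.
have dr := diff_derivable (v := d) df.
split; first by rewrite /derivable E.
by rewrite -deriveE // /derive E.
Qed.

(** The derivative of phi(t) - t phi'(0) at t is at most K t in absolute value,
    so subtracting K t^2 / 2 from either it or its opposite leaves a function
    with nonpositive slope on ]0, 1[, to which the mean value theorem applies. *)
Lemma taylor1_lipschitz_derivative {R : realType} (phi dphi : R -> R) (K : R) :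
  (forall t : R, is_derive t 1 phi (dphi t)) ->
  (forall t, 0 < t -> `|dphi t - dphi 0| <= K * t) ->
  `|phi 1 - phi 0 - dphi 0| <= K / 2.
Proof.
move=> phiD lip.
have signed (s : R) : `|s| = 1 -> s * (phi 1 - phi 0 - dphi 0) <= K / 2.
  move=> s1.
  (* The sign s treats the upper and the lower bound at once. *)
  pose g (t : R) := s * (phi t - t * dphi 0) - K / 2 * t ^+ 2.
  pose g' (t : R) := s * (dphi t - dphi 0) - K * t.
  have gD (t : R) : is_derive t 1 g (g' t).
    have phiDt := phiD t.
    rewrite /g; apply: is_derive_eq.
    rewrite /g' /GRing.scale /=; lra.
  have gC : ({within `[0, 1], continuous g})%classic.
    by apply: derivable_within_continuous => t _; have [] := gD t.
  have [c c01] := MVT ltr01 (fun t _ => gD t) gC.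
  have c0 : 0 < c by move: c01; rewrite in_itv /= => /andP[].
  have slope : s * (dphi c - dphi 0) <= K * c.
    apply: le_trans (lip c c0).
    by rewrite (le_trans (ler_norm _)) // normrM s1 mul1r.
  rewrite /g /g' => gE; move: slope gE; lra.
have := signed 1 (normr1 _); have := signed (-1) (normrN1 _).
rewrite ler_norml; lra.
Qed.

(** The derivative of t |-> f(w + t d) moves away from its value at 0 at rate
    at most nu ||d||^2: one factor ||d|| comes from the displacement t d of the
    base point, the other from differentiating in the direction d. *)
Lemma taylor1_C11 {R : realType} {n : nat} (nu : R)
    (f : 'rV[R]_n -> R) (w d : 'rV[R]_n) :
  0 < nu -> C11 nu f ->
  `|f (w + d) - f w - 'd f w d| <= nu / 2 * enorm d ^+ 2.
Proof.
move=> nu0 [df _ lip].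
have phiD (t : R) := is_derive_line f w d t (df _).
have := @taylor1_lipschitz_derivative R _ _ (nu * enorm d ^+ 2) phiD.
rewrite scale1r scale0r addr0 [leRHS]mulrAC; apply => t t0.
rewrite diff_subr_Df mulrAC; apply: dot_le_of_enorm_le; first exact: mulr_gt0.
have := lip (w + t *: d) w.
by rewrite [w + _ - w]addrC addKr enorm_scale_ge0 ?mulrA // ltW.
Qed.

(** Affine independence of the n+1 points p_i is linear independence of the n+1
    rows (1, p_i), which live in dimension 1+n and hence span the whole space;
    the coordinates of (1, u) in these rows are the barycentric ones of u. *)
Lemma affinely_independent_spans {R : realType} {n : nat}
    (p : 'I_n.+1 -> 'rV[R]_n) (u : 'rV[R]_n) :
  affinely_independent p ->
  exists a : 'I_n.+1 -> R, \sum_i a i = 1 /\ \sum_i a i *: p i = u.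
Proof.
move=> ind.
pose M : 'M[R]_(n.+1, 1 + n) := row_mx (const_mx 1) (\matrix_i p i).
have mulM (c : 'rV[R]_n.+1) :
    c *m M = row_mx (\sum_i c 0 i)%:M (\sum_i c 0 i *: p i).
  rewrite mul_mx_row; congr row_mx.
    apply/rowP => j; rewrite !mxE ord1 mulr1n.
    by apply: eq_bigr => i _; rewrite mxE mulr1.
  by rewrite mulmx_sum_row; apply: eq_bigr => i _; rewrite rowK.
have freeM : row_free M.
  apply: inj_row_free => c cM.
  have := etrans (esym (mulM c)) (etrans cM (esym (row_mx0 _ _ _ _))).
  move=> /eq_row_mx[/matrixP/(_ 0 0)]; rewrite !mxE mulr1n => c0 c1.
  by apply/rowP => i; rewrite mxE; apply: (ind (c 0)).
(* M is square, so both properties say that its rank is n+1. *)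
have fullM : row_full M by exact: freeM.
have /submxP[c] := submx_full (row_mx 1%:M u) fullM.
rewrite mulM => /eq_row_mx[/matrixP/(_ 0 0)]; rewrite !mxE !mulr1n => c1 cu.
by exists (c 0).
Qed.

Lemma affine_fun_barycentric {R : realType} {n m : nat} (g : 'rV[R]_n -> R)
    (a : 'I_m -> R) (p : 'I_m -> 'rV[R]_n) :
  affine_fun g -> \sum_i a i = 1 ->
  g (\sum_i a i *: p i) = \sum_i a i * g (p i).
Proof.
move=> [L [b gE]] a1; rewrite gE linear_sum.
rewrite -[X in _ + X]mul1r -a1 mulr_suml -big_split; apply: eq_bigr => i _.
by rewrite gE linearZ /= mulrDr.
Qed.

(** An affine function is determined by its values on Theta, so ell_i, which is 1
    at p_i and 0 at the other points, reads off the i-th barycentric coordinate. *)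
Lemma lagrange_barycentric {R : realType} {n : nat}
    (p : 'I_n.+1 -> 'rV[R]_n) (ell : 'I_n.+2 -> 'rV[R]_n -> R) (u : 'rV[R]_n) :
  affinely_independent p -> lagrange_family p ell ->
  \sum_i ell (lift ord0 i) u = 1 /\ \sum_i ell (lift ord0 i) u *: p i = u.
Proof.
move=> ind [_ lag].
have [a [a1 au]] := affinely_independent_spans p u ind.
have aE i : ell (lift ord0 i) u = a i.
  have [aff ev] := lag i.
  rewrite -{1}au affine_fun_barycentric // (bigD1 i) //= ev eqxx mulr1.
  by rewrite big1 ?addr0 // => j /negPf ji; rewrite ev ji mulr0.
by split; [rewrite -a1|rewrite -[RHS]au]; apply: eq_bigr => i _; rewrite aE.
Qed.

Theorem corollary4p2 (R : realType) (n : nat) (nu : R) (f : 'rV[R]_n -> R)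
    (x : 'I_n.+2 -> 'rV[R]_n) (ell : 'I_n.+2 -> 'rV[R]_n -> R)
    (fhat : 'rV[R]_n -> R) :
  0 < nu ->
  C11 nu f ->
  affinely_independent (Theta x) ->
  lagrange_family (Theta x) ell ->
  interpolant (Theta x) f fhat ->
  `|fhat (x ord0) - f (x ord0)| <= zbar nu x ell.
Proof.
move=> nu0 fC ind lag [aff int].
have [l1 lx] := lagrange_barycentric _ ell (x ord0) ind lag.
have l0 : ell ord0 (x ord0) = -1 by case: lag.
(* From here on w is arbitrary. *)
rewrite /zbar; move: (wpoint x ell) => w.
have fhatE : fhat (x ord0) - f (x ord0) = \sum_i ell i (x ord0) * f (x i).
  rewrite -{1}lx affine_fun_barycentric // [RHS]big_ord_recl l0 mulN1r addrC.
  by congr (_ + _); apply: eq_bigr => i _; rewrite int.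
(* The first-order Taylor polynomial of f at w is reproduced exactly. *)
have rem0 : \sum_i ell i (x ord0) * (f w + 'd f w (x i - w)) = 0.
  have affw : affine_fun (fun u => f w + 'd f w (u - w)).
    exists ('d f w), (f w - 'd f w w) => u; rewrite linearB /=; lra.
  rewrite big_ord_recl l0 mulN1r.
  have := affine_fun_barycentric _ _ (Theta x) affw l1.
  by rewrite lx => <-; rewrite addNr.
have -> : fhat (x ord0) - f (x ord0) =
    \sum_i ell i (x ord0) * (f (x i) - (f w + 'd f w (x i - w))).
  rewrite fhatE -[LHS]subr0 -[X in _ - X]rem0 -sumrB.
  by apply: eq_bigr => i _; rewrite mulrBr.
rewrite mulr_sumr.
apply: le_trans (ler_norm_sum _ _ _) _; apply: ler_sum => i _.
rewrite normrM mulrCA; apply: ler_wpM2l => //.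
have := taylor1_C11 nu f w (x i - w) nu0 fC.
by rewrite [w + _]addrC subrK opprD addrA.
Qed.
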